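(* Let $G$ be a simple connected graph of order $n\ge 3$ and diameter $d$. Then $md(G)\ge f(n,d)$, where $f(n,d)$ is the least positive integer $k$ such that $\frac{(k+d-1)!}{k!\,(d-1)!}+k\ge n$.
   Context: For vertices $u,v$ of a connected graph $G$, $d(u,v)$ is the length of a shortest $u$–$v$ path; the diameter is the maximum distance. For $W\subseteq V(G)$ and $v\in V(G)$, $r_m(v|W)$ is the multiset $\{d(v,w): w\in W\}$. $W$ is an m-resolving set if $r_m(u|W)\neq r_m(v|W)$ for all distinct $u,v\in V(G)$. If $G$ has an m-resolving set, $md(G)$ is the minimum cardinality of one; otherwise $md(G)=\infty$. *)

(* Defs.v *)
From mathcomp Require Import all_boot all_order all_algebra.
From mathcomp Require Import finmap multiset.

Set Implicit Arguments.
Unset Strict Implicit.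
Unset Printing Implicit Defensive.

Import Order.TTheory GRing.Theory Num.Theory.

Local Open Scope mset_scope.
Local Open Scope nat_scope.

(* A graph is an adjacency relation [e] on a finite type [T] of vertices. *)

Definition simple_graph (T : finType) (e : rel T) : Prop :=
  symmetric e /\ irreflexive e.

Definition connected_graph (T : finType) (e : rel T) : Prop :=
  forall u v : T, connect e u v.

(* A path of length [k] is written as its [k] vertices after [u]. *)
Definition has_path (T : finType) (e : rel T) (u v : T) (k : nat) : bool :=
  [exists p : k.-tuple T,
    [&& path e u p, uniq (u :: p) & last u p == v]].

(* As [find] runs over 0, 1, ..., #|T| - 1, the index it returns is the least
   such length; a path has fewer than #|T| edges, so none is missed.  The junk
   value #|T| is returned only if no u-v path exists. *)
Definition dist (T : finType) (e : rel T) (u v : T) : nat :=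
  find (has_path e u v) (iota 0 #|T|).

Definition diameter (T : finType) (e : rel T) : nat :=
  \max_(u : T) \max_(v : T) dist e u v.

Definition mrepr (T : finType) (e : rel T) (v : T) (W : {set T}) : {mset nat} :=
  seq_mset [seq dist e v w | w <- enum W].

Definition mresolving (T : finType) (e : rel T) (W : {set T}) : bool :=
  [forall u : T, forall v : T, (u != v) ==> (mrepr e u W != mrepr e v W)].

(* [None] stands for infinity. *)
Definition md (T : finType) (e : rel T) : option nat :=
  if [pick W : {set T} | mresolving e W] is Some W0
  then Some #|[arg min_(W < W0 | mresolving e W) #|W| ]|
  else None.

Definition le_md (k : nat) (m : option nat) : Prop :=
  if m is Some m' then k <= m' else True.

(* The quotient is taken in [rat], so no rounding occurs.  The subtraction
   [d - 1] is truncated, hence only meaningful for [d >= 1]. *)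
Definition f_cond (n d k : nat) : bool :=
  (0 < k) &&
  (n%:R <= (k + d - 1)`!%:R / (k`!%:R * (d - 1)`!%:R) + k%:R :> rat)%R.

Lemma f_cond_ex (n d : nat) : exists k, f_cond n d k.
Proof.
exists n.+1; rewrite /f_cond /=.
apply: (@le_trans _ _ n.+1%:R%R); first by rewrite ler_nat.
by rewrite lerDr divr_ge0 ?mulr_ge0 ?ler0n.
Qed.

Definition f (n d : nat) : nat := ex_minn (f_cond_ex n d).

(* Main.v *)
(** A vertex outside [W] is at positive distance from every element of [W], so
    its code is a multiset of [#|W|] numbers taken from [1, ..., d]; there are
    ['C(#|W| + d - 1, #|W|)] of these.  The vertices of [W] account for the
    extra summand [#|W|]. *)
Require Import Defs.
From mathcomp Require Import all_boot all_order all_algebra.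
From mathcomp Require Import finmap multiset.

Import Order.TTheory GRing.Theory Num.Theory.

(** Sorting turns each multiset into a nondecreasing [k]-tuple over the [d.+1] values [0, ..., d],
    and [card_sorted_tuples] counts these. *)
Lemma card_le_multisets (A : finType) (S : {set A}) (k d : nat)
    (g : A -> seq nat) :
  {in S, forall x, size (g x) = k} ->
  {in S, forall x, all (geq d) (g x)} ->
  {in S &, forall x y, perm_eq (g x) (g y) -> x = y} ->
  #|S| <= 'C(k + d, k).
Proof.
move=> size_g g_le g_inj.
pose h x : k.-tuple 'I_d.+1 := [tuple inord (nth 0 (sort leq (g x)) i) | i < k].
(* The entries are at most [d], so [inord] never falls back to its default value. *)
have hE : {in S, forall x, map val (h x) = sort leq (g x)}.
  move=> x Sx; apply: (@eq_from_nth _ 0) => [|i].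
    by rewrite size_map size_tuple size_sort size_g.
  rewrite size_map size_tuple => ltik.
  rewrite (nth_map ord0) ?size_tuple // -(tnth_nth _ _ (Ordinal ltik)).
  rewrite tnth_mktuple [LHS]inordK // ltnS.
  have /allP := g_le x Sx; apply; rewrite -(mem_sort leq) mem_nth //.
  by rewrite size_sort size_g.
rewrite -card_sorted_tuples -(@card_in_imset _ _ h).
  apply/subset_leq_card/subsetP => _ /imsetP[x Sx ->].
  by rewrite inE hE // sort_sorted //; exact: leq_total.
move=> x y Sx Sy hxy; apply: g_inj => //.
by rewrite -(perm_sort leq) -(hE x) // hxy hE // perm_sort.
Qed.

(** As [T] is inhabited, the search starts at length 0, where only the empty path from [u] to itself
    qualifies. *)
Lemma dist_gt0 (T : finType) (e : rel T) (u v : T) : u != v -> 0 < dist e u v.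
Proof.
move=> neq_uv; rewrite /dist; case cardT_eq: #|T| => [|m] /=.
  by have := fintype0 u cardT_eq.
case: ifP => // /existsP[p]; rewrite (tuple0 p) /= => /eqP eq_uv.
by rewrite eq_uv eqxx in neq_uv.
Qed.

Lemma dist_le_diameter (T : finType) (e : rel T) (u v : T) :
  dist e u v <= diameter e.
Proof. by rewrite /diameter (bigD1 u) //= leq_max (bigD1 v) //= leq_max leqnn. Qed.

Lemma mresolving_inj (T : finType) (e : rel T) (W : {set T}) (u v : T) :
  mresolving e W -> mrepr e u W = mrepr e v W -> u = v.
Proof.
move=> /forallP/(_ u)/forallP/(_ v); rewrite implybE negbK => /orP[/eqP //|].
by move=> /[swap] ->; rewrite eqxx.
Qed.

Lemma mresolving_card_le (T : finType) (e : rel T) (W : {set T}) :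
  mresolving e W -> #|T| <= 'C(#|W| + (diameter e).-1, #|W|) + #|W|.
Proof.
move=> resW; rewrite -(cardsC W) addnC leq_add2r.
(* Predecessors shift the distances from [1, ..., d] to [0, ..., d - 1], the range being counted. *)
apply: (@card_le_multisets _ _ _ _
  (fun v => [seq (dist e v w).-1 | w <- enum W])) => [x _|x _|x y].
- by rewrite size_map -cardE.
- apply/allP => _ /mapP[w _ ->] /=.
  by rewrite -!subn1 leq_sub2r // dist_le_diameter.
rewrite !inE => Wx Wy /(perm_map S); rewrite -!map_comp => perm_xy.
apply: (mresolving_inj _ e W) => //; apply/eq_seq_msetP.
(* Outside [W] no distance is 0, so the shift loses nothing. *)
have succK v : v \notin W ->
    map (S \o (fun w => (dist e v w).-1)) (enum W) = map (dist e v) (enum W).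
  move=> Wv; apply/eq_in_map => w; rewrite mem_enum /= => Ww.
  by rewrite prednK // dist_gt0 //; apply: contraNneq Wv => ->.
by rewrite -!succK.
Qed.

(** If [W] is empty, all vertices share the empty code. *)
Lemma mresolving_gt0 (T : finType) (e : rel T) (W : {set T}) :
  1 < #|T| -> mresolving e W -> 0 < #|W|.
Proof.
move=> /card_gt1P[x [y [_ _ neq_xy]]] resW; rewrite card_gt0.
apply: contraNneq neq_xy => W0; apply/eqP/(mresolving_inj _ e W) => //.
by rewrite /mrepr W0 enum_set0.
Qed.

Lemma diameter_gt0 (T : finType) (e : rel T) : 1 < #|T| -> 0 < diameter e.
Proof.
move=> /card_gt1P[x [y [_ _ neq_xy]]].
exact: leq_trans (dist_gt0 T e x y neq_xy) (dist_le_diameter T e x y).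
Qed.

Lemma f_condE (n d k : nat) :
  0 < d -> f_cond n d k = (0 < k) && (n <= 'C(k + d.-1, k) + k).
Proof.
case: d => // d _; rewrite /f_cond addnS !subn1 /= -(ler_nat rat n) natrD.
congr (_ && (_ <= _ + _)%R).
(* The factorial in the numerator is the binomial times the denominator, so the division in [rat] is
   exact. *)
rewrite -(bin_fact (leq_addr d k)) addKn !natrM mulfK //.
by rewrite mulf_neq0 // pnatr_eq0 -lt0n fact_gt0.
Qed.

Lemma f_le (T : finType) (e : rel T) (W : {set T}) :
  1 < #|T| -> mresolving e W -> f #|T| (diameter e) <= #|W|.
Proof.
move=> T_gt1 resW; rewrite /f; case: ex_minnP => k _; apply.
rewrite f_condE; last exact: diameter_gt0.
by rewrite (mresolving_gt0 T e) // mresolving_card_le.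
Qed.

Theorem theorem2p8 (T : finType) (e : rel T) (n d : nat)
    (e_simple : simple_graph e) (e_connected : connected_graph e)
    (order_n : #|T| = n) (n_ge3 : 3 <= n) (diam_d : diameter e = d) :
  le_md (f n d) (md e).
Proof.
(* With no resolving set [md] is infinite and the bound is trivial. *)
rewrite /md; case: pickP => [W0 resW0|] //=.
case: arg_minnP => // W resW _; rewrite -order_n -diam_d.
by apply: f_le => //; rewrite order_n ltnW.
Qed.
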